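(* Let $G$ be a finite group and let $F$ be a field of characteristic not dividing $|G|$. Let $I$ be the two-sided ideal of the group ring $F[G]$ generated by the norms $\mathbf{N} H$ of nontrivial subgroups $H$ of $G$. Then $G$ is freely representable over $F$ if and only if $I$ is a proper ideal of $F[G]$.
   Context: For a subgroup $H$ of a finite group $G$, the norm of $H$ is the element $\mathbf{N} H = \sum_{\sigma \in H} \sigma$ of $F[G]$. A free linear representation of a group $G$ over a field $F$ is a linear action of $G$ on an $F$-vector space $V \neq 0$ such that $gv \neq v$ for all $g \neq 1$ in $G$ and all nonzero $v \in V$. A finite group is freely representable over $F$ if it has a free linear representation on some $F$-vector space. A field of characteristic $0$ is considered to have characteristic not dividing $|G|$. *)

(* Defs.v *)
From mathcomp Require Import all_boot all_order all_algebra all_fingroup.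
From mathcomp Require Import all_solvable all_field all_character.

Set Implicit Arguments.
Unset Strict Implicit.
Unset Printing Implicit Defensive.

Import GRing.Theory.
Local Open Scope ring_scope.

(* The values of rho outside G are irrelevant.  V is an arbitrary F-vector    *)
(* space, possibly infinite-dimensional.                                      *)
Definition linear_action (F : fieldType) (gT : finGroupType) (G : {group gT})
    (V : lmodType F) (rho : gT -> {linear V -> V}) : Prop :=
  (forall v, rho 1%g v = v) /\
  (forall g h, g \in G -> h \in G -> forall v, rho (g * h)%g v = rho g (rho h v)).

Definition free_linear_rep (F : fieldType) (gT : finGroupType) (G : {group gT})
    (V : lmodType F) (rho : gT -> {linear V -> V}) : Prop :=
  [/\ linear_action G rho,
      exists v : V, v != 0
    & forall g, g \in G -> g != 1%g -> forall v : V, v != 0 -> rho g v != v].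

Definition freely_representable (F : fieldType) (gT : finGroupType)
    (G : {group gT}) : Prop :=
  exists (V : lmodType F) (rho : gT -> {linear V -> V}), free_linear_rep G rho.

(* F[G] is the library's group_ring F G, whose row space consists of the      *)
(* (vectorised) F-combinations of the linearly independent matrices           *)
(* regular_repr F G x, x in G; the norm of H is                               *)
(* gset_mx F G H = \sum_(x in H) regular_repr F G x.                          *)
Definition norm_span (F : fieldType) (gT : finGroupType) (G : {group gT}) :
    'A[F]_#|G| :=
  (\sum_(H : {group gT} | (H \subset G) && (H :!=: 1%g))
      <<mxvec (gset_mx F G H)>>)%MS.

(* The two-sided ideal generated by a set S is the span F[G] S F[G] of the    *)
(* products a * s * b; see norm_ideal_least.                                  *)
Definition norm_ideal (F : fieldType) (gT : finGroupType) (G : {group gT}) :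
    'A[F]_#|G| :=
  (group_ring F G * norm_span F G * group_ring F G)%MS.

Lemma norm_in_span (F : fieldType) (gT : finGroupType) (G H : {group gT}) :
  H \subset G -> H :!=: 1%g -> (gset_mx F G H \in norm_span F G)%MS.
Proof.
move=> sHG ntH; rewrite /norm_span (bigD1 H) ?sHG //=.
by apply: submx_trans (addsmxSl _ _); rewrite genmxE.
Qed.

Lemma group_ring1 (F : fieldType) (gT : finGroupType) (G : {group gT}) :
  (1%:M \in group_ring F G)%MS.
Proof. by rewrite -(repr_mx1 (regular_repr F G)) envelop_mx_id. Qed.

Lemma group_ringM (F : fieldType) (gT : finGroupType) (G : {group gT}) :
  (group_ring F G * group_ring F G <= group_ring F G)%MS.
Proof.
by apply/mulsmx_subP=> A B RA RB; apply: envelop_mxM.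
Qed.

Lemma norm_ideal_least (F : fieldType) (gT : finGroupType) (G : {group gT}) :
  [/\ (norm_ideal F G <= group_ring F G)%MS,
      mx_ideal (group_ring F G) (norm_ideal F G),
      forall H : {group gT}, H \subset G -> H :!=: 1%g ->
        (gset_mx F G H \in norm_ideal F G)%MS
    & forall m (J : 'A[F]_(m, #|G|)), mx_ideal (group_ring F G) J ->
        (forall H : {group gT}, H \subset G -> H :!=: 1%g ->
          (gset_mx F G H \in J)%MS) ->
        (norm_ideal F G <= J)%MS].
Proof.
have sNR : (norm_span F G <= group_ring F G)%MS.
  apply/sumsmx_subP=> H /andP[sHG _]; rewrite genmxE /gset_mx linear_sum.
  by apply: summx_sub => x Hx; rewrite envelop_mx_id // (subsetP sHG).
have RR := @group_ringM F _ G.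
split.
- apply: submx_trans (RR); apply: mulsmxS => //.
  by apply: submx_trans (RR); apply: mulsmxS.
- rewrite /mx_ideal /left_mx_ideal /right_mx_ideal /norm_ideal; apply/andP.
  split; last by rewrite -(mulsmxA (_ * _)%MS); apply: mulsmxS.
  by rewrite !mulsmxA; do 2![apply: mulsmxS => //].
- move=> H sHG ntH; rewrite -[gset_mx F G H]mulmx1 -[gset_mx F G H]mul1mx.
  by rewrite !mem_mulsmx ?group_ring1 ?norm_in_span.
move=> m J /andP[lJ rJ] NJ; apply: submx_trans rJ; apply: mulsmxS => //.
apply: submx_trans lJ; apply: mulsmxS => //.
by apply/sumsmx_subP=> H /andP[sHG ntH]; rewrite genmxE NJ.
Qed.

(* Main.v *)
Require Import Defs.
From HB Require Import structures.
From mathcomp Require Import all_boot all_order all_algebra all_fingroup.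
From mathcomp Require Import all_solvable all_field all_character.

(** On a free representation [V], every norm [N H] with [H != 1] acts as [0],
    because its image is fixed by [H]; hence so does [I], and [1] is not in [I].
    Conversely, when [I] is proper, [G] acts freely on the nonzero quotient
    [F[G] / I]: a vector [v] fixed by [g != 1] satisfies
    [#[g] v = (N <[g]>) v = 0], and [#[g]] is invertible in [F]. *)

Local Open Scope ring_scope.
Import GRing.Theory.

Section FreeRepresentation.

Variables (F : fieldType) (gT : finGroupType) (G : {group gT}).
Variables (V : lmodType F) (rho : gT -> {linear V -> V}).
Hypothesis actG : linear_action G rho.
Local Notation aG := (regular_repr F G).

(* Row [gring_index G 1] of [A] in [group_ring F G] lists its coordinates on
   the elements of [G]; off the group ring the value is meaningless. *)
Definition group_ring_act (v : V) (A : 'M[F]_#|G|) : V :=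
  \sum_(x in G) A (gring_index G 1%g) (gring_index G x) *: rho x v.

Lemma group_ring_act_is_linear v : linear (group_ring_act v).
Proof.
move=> a A B; rewrite /group_ring_act scaler_sumr -big_split.
by apply: eq_bigr => x _; rewrite !mxE scalerDl scalerA.
Qed.

HB.instance Definition _ v := GRing.isLinear.Build F 'M[F]_#|G| V *:%R
  (group_ring_act v) (group_ring_act_is_linear v).

Lemma group_ring_act_regular v x : x \in G -> group_ring_act v (aG x) = rho x v.
Proof.
move=> Gx; rewrite /group_ring_act (bigD1 x) //= big1 ?addr0 => [|y /andP[Gy neyx]].
  by rewrite !mxE gring_indexK // mul1g !eqxx scale1r.
rewrite !mxE gring_indexK // mul1g (inj_in_eq (can_in_inj (@gring_indexK gT G))) //=.
by rewrite (negPf neyx) scale0r.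
Qed.

(** Both sides are bilinear in [A] and [B], so it suffices to compare them on group elements, where
    this is [rhoM]. *)
Lemma group_ring_actM v A B :
  (A \in group_ring F G)%MS -> (B \in group_ring F G)%MS ->
  group_ring_act v (A *m B) = group_ring_act (group_ring_act v B) A.
Proof.
case/envelop_mxP=> a ->{A} /envelop_mxP[b ->{B}].
have [_ rhoM] := actG.
rewrite mulmx_suml !linear_sum; apply: eq_bigr => x Gx.
rewrite [in RHS]linearZ /= group_ring_act_regular //.
rewrite mulmx_sumr !linear_sum; apply: eq_bigr => y Gy /=.
rewrite -scalemxAl -scalemxAr -repr_mxM // !linearZ /=.
by rewrite !group_ring_act_regular ?groupM // rhoM // linearZ.
Qed.

Hypothesis free : forall g, g \in G -> g != 1%g ->
  forall v : V, v != 0 -> rho g v != v.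

Lemma norm_act_eq0 (H : {group gT}) v :
  H \subset G -> H :!=: 1%g -> group_ring_act v (gset_mx F G H) = 0.
Proof.
move=> sHG ntH; have [g Hg ntg] := trivgPn _ ntH; have [_ rhoM] := actG.
have Gg := subsetP sHG g Hg.
rewrite /gset_mx linear_sum; set w := (\sum_(x in H) _).
have def_w : w = \sum_(x in H) rho x v.
  by apply: eq_bigr => x Hx; apply/group_ring_act_regular/(subsetP sHG).
apply/eqP; apply: contraT => nz_w.
(* Left translation by [g] permutes [H], so [rho g] fixes [w]. *)
case/eqP: (free g Gg ntg w nz_w); rewrite def_w linear_sum.
rewrite [RHS](reindex_inj (mulgI g)); apply: eq_big => x; first by rewrite groupMl.
by move=> Hx; rewrite rhoM ?(subsetP sHG).
Qed.

Lemma norm_span_act_eq0 v A : (A \in norm_span F G)%MS -> group_ring_act v A = 0.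
Proof.
case/memmx_sumsP=> N -> normN; rewrite linear_sum big1 // => H /andP[sHG ntH].
have /sub_rVP[a /(congr1 vec_mx)] : (mxvec (N H) <= mxvec (gset_mx F G H))%MS.
  by rewrite -(genmxE (mxvec (gset_mx F G H))).
by rewrite mxvecK linearZ /= mxvecK => ->; rewrite linearZ /= norm_act_eq0 ?scaler0.
Qed.

Lemma norm_span_sub : (norm_span F G <= group_ring F G)%MS.
Proof.
apply/sumsmx_subP=> H /andP[sHG _]; rewrite genmxE /gset_mx linear_sum.
by apply: summx_sub => x Hx; rewrite envelop_mx_id // (subsetP sHG).
Qed.

(** In a product [D * E * C] with [E] in the norm span, [C] acts first and merely replaces [v] by
    another vector; [E] kills every vector, and [D] then acts on 0. *)
Lemma norm_ideal_act_eq0 v A : (A \in norm_ideal F G)%MS -> group_ring_act v A = 0.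
Proof.
have act0 B : group_ring_act 0 B = 0.
  by rewrite /group_ring_act big1 // => x _; rewrite linear0 scaler0.
case/mulsmxP=> B RNB [C RC ->{A}]; rewrite linear_sum big1 // => i _ /=.
have sRN_R : (group_ring F G * norm_span F G <= group_ring F G)%MS.
  by apply: submx_trans (@group_ringM F gT G); apply/mulsmxS/norm_span_sub.
rewrite group_ring_actM ?(submx_trans (RNB i)) //.
case/mulsmxP: (RNB i) => D RD [E NE ->]; rewrite linear_sum big1 // => j _ /=.
rewrite group_ring_actM ?(submx_trans (NE j)) ?norm_span_sub //.
by rewrite (norm_span_act_eq0 _ (E j)) ?act0.
Qed.

End FreeRepresentation.

Lemma freely_representable_proper (F : fieldType) (gT : finGroupType)
    (G : {group gT}) :
  freely_representable F G -> (norm_ideal F G < group_ring F G)%MS.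
Proof.
case=> V [rho [actG [v nz_v] free]].
have [sIR _ _ _] := @norm_ideal_least F gT G.
rewrite /ltmx sIR; apply: contra nz_v => sRI.
have I1 := submx_trans (@group_ring1 F gT G) sRI.
have:= norm_ideal_act_eq0 _ _ _ _ _ actG free v _ I1.
rewrite -(repr_mx1 (regular_repr F G)) group_ring_act_regular //.
by case: actG => -> _ ->.
Qed.

Section QuotientRepresentation.

Variables (F : fieldType) (gT : finGroupType) (G : {group gT}).
Local Notation aG := (regular_repr F G).
Local Notation I := (norm_ideal F G).

(** [I] consists of vectorised square matrices; [gring_row] carries it to coordinate rows of length
    [#|G|], that is, into the regular module, where a quotient representation can be formed. *)
Definition norm_ideal_row : 'M[F]_#|G| :=
  <<I *m lin1_mx (@gring_row F gT G \o vec_mx)>>%MS.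

Lemma norm_ideal_rowP (u : 'rV[F]_#|G|) :
  reflect (exists2 A, (A \in I)%MS & u = gring_row A) (u <= norm_ideal_row)%MS.
Proof.
rewrite genmxE; apply: (iffP submxP) => [[w ->] | [A /submxP[w defA] ->]].
  exists (vec_mx (w *m I)); first by rewrite vec_mxK submxMl.
  by rewrite mulmxA mul_rV_lin1.
by exists w; rewrite mulmxA -defA mul_rV_lin1 /= mxvecK.
Qed.

Lemma norm_ideal_mulr A B :
  (A \in I)%MS -> (B \in group_ring F G)%MS -> (A *m B \in I)%MS.
Proof.
have [_ /andP[_ rI] _ _] := @norm_ideal_least F gT G.
by move=> IA RB; apply: submx_trans rI; apply: mem_mulsmx.
Qed.

Lemma norm_ideal_mull A B :
  (A \in group_ring F G)%MS -> (B \in I)%MS -> (A *m B \in I)%MS.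
Proof.
have [_ /andP[lI _] _ _] := @norm_ideal_least F gT G.
by move=> RA IB; apply: submx_trans lI; apply: mem_mulsmx.
Qed.

(** The regular module is acted on by right multiplication, so this is the right ideal property of
    [I]. *)
Lemma norm_ideal_row_module : mxmodule aG norm_ideal_row.
Proof.
apply/mxmoduleP=> x Gx; apply/row_subP=> i; rewrite row_mul.
have /norm_ideal_rowP[A IA ->] := row_sub i norm_ideal_row.
apply/norm_ideal_rowP; exists (A *m aG x); last by rewrite gring_row_mul.
by rewrite norm_ideal_mulr ?envelop_mx_id.
Qed.

Lemma gring_mx_in (u : 'rV[F]_#|G|) : (gring_mx aG u \in group_ring F G)%MS.
Proof. by rewrite /gring_mx /= vec_mxK submxMl. Qed.

(** This makes norms act as 0 on the quotient: [u] is the row of some [a] in F[G], and [a * N H]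
    lies in [I] because [I] is a left ideal. *)
Lemma mul_norm_row (H : {group gT}) (u : 'rV[F]_#|G|) :
  H \subset G -> H :!=: 1%g -> (u *m gset_mx F G H <= norm_ideal_row)%MS.
Proof.
move=> sHG ntH; have [_ _ normI _] := @norm_ideal_least F gT G.
apply/norm_ideal_rowP; exists (gring_mx aG u *m gset_mx F G H).
  by rewrite norm_ideal_mull ?gring_mx_in ?normI.
by rewrite gring_row_mul gring_mxK.
Qed.

(** [gring_row] is injective on the group ring, so the row of 1 can only come from 1 itself, and an
    ideal containing 1 is everything. *)
Lemma norm_ideal_row_proper :
  (I < group_ring F G)%MS -> ~~ (gring_row 1%:M <= norm_ideal_row)%MS.
Proof.
case/andP=> sIR; apply: contra => /norm_ideal_rowP[A IA eq_rows].
have RA := submx_trans IA sIR.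
have I1 : (1%:M \in I)%MS.
  by rewrite -(gring_rowK (@group_ring1 F gT G)) eq_rows gring_rowK.
by apply/memmx_subP=> B RB; rewrite -[B]mulmx1 norm_ideal_mull.
Qed.

Local Notation qG := (factmod_repr norm_ideal_row_module).

Lemma quotient_fixed_eq0 g (v : 'rV[F]_(\rank (cokermx norm_ideal_row))) :
    #|G|%:R != 0 :> F -> g \in G -> g != 1%g -> v *m qG g = v -> v = 0.
Proof.
move=> nzG Gg ntg fix_v.
have sgG : <[g]>%g \subset G by rewrite cycle_subG.
have fix_vg x : x \in <[g]>%g -> v *m qG x = v.
  case/cycleP=> k ->; elim: k => [|k IHk]; first by rewrite repr_mx1 mulmx1.
  by rewrite expgS repr_mxM ?groupX // mulmxA fix_v.
(* Lift [v] to the regular module, apply the norm of [<[g]>] and project back; expanding the norm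
   termwise then turns this into [#|<[g]>| * v = 0]. *)
have /eqP: in_factmod norm_ideal_row (val_factmod v *m gset_mx F G <[g]>%g) = 0.
  by apply/eqP; rewrite in_factmod_eq0 mul_norm_row // cycle_eq1.
rewrite /gset_mx mulmx_sumr linear_sum /=.
under eq_bigr => x gx.
  rewrite (in_factmodJ norm_ideal_row_module) ?(subsetP sgG) // val_factmodK.
  rewrite fix_vg //; over.
rewrite sumr_const -scaler_nat scaler_eq0 => /orP[/eqP g0 | /eqP //].
(* The order of [g] divides [#|G|], so its vanishing in [F] would make [#|G|] vanish too. *)
by case/eqP: nzG; rewrite -(Lagrange sgG) natrM g0 mul0r.
Qed.

Lemma proper_freely_representable :
  #|G|%:R != 0 :> F -> (I < group_ring F G)%MS -> freely_representable F G.
Proof.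
move=> nzG ltIR.
(* Matrices act on row vectors from the right, whence the inverse. *)
exists 'rV[F]_(\rank (cokermx norm_ideal_row)), (fun g => mulmxr (qG g^-1%g)).
split.
- split=> [v | g h Gg Gh v] /=; first by rewrite invg1 repr_mx1 mulmx1.
  by rewrite invMg repr_mxM ?groupV // mulmxA.
(* The class of 1 is nonzero because [I] is proper. *)
- exists (in_factmod norm_ideal_row (gring_row 1%:M)).
  by rewrite in_factmod_eq0 norm_ideal_row_proper.
move=> g Gg ntg v /=; apply: contra => /eqP fix_v.
by rewrite (quotient_fixed_eq0 g^-1%g v) ?groupV ?invg_eq1.
Qed.

End QuotientRepresentation.

(** A positive [n] vanishing in [F] forces a positive characteristic, which divides [n]; in
    characteristic 0 the divisibility hypothesis is vacuous. *)
Lemma natf_neq0_pchar (F : fieldType) (n : nat) :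
  (0 < n)%N -> (forall p, p \in [pchar F] -> ~~ (p %| n)%N) -> n%:R != 0 :> F.
Proof.
move=> n_gt0 ndvd; apply/negP => n0.
have [p charFp] := natf0_pchar n_gt0 n0.
by case/negP: (ndvd p charFp); rewrite (dvdn_pcharf charFp).
Qed.

Theorem theorem11 (F : fieldType) (gT : finGroupType) (G : {group gT})
    (char_ndvd : forall p : nat, p \in [pchar F] -> ~~ (p %| #|G|)%N) :
  freely_representable F G <-> (norm_ideal F G < group_ring F G)%MS.
Proof.
split; first exact: freely_representable_proper.
exact/proper_freely_representable/natf_neq0_pchar.
Qed.
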